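(* Let $m\ge 2$ and let $\mathcal F=\mathcal F_\Theta$, $\mathcal F(x)=W_2\,\mathrm{Relu}(W_1x+b_1)+b_2$, with $W_1\in\mathbb R^{n_1\times n}$, $b_1\in\mathbb R^{n_1}$, $W_2\in\mathbb R^{m\times n_1}$, $b_2\in\mathbb R^m$, $\Theta=\{W_1,b_1,W_2,b_2\}$, be a (trained) network which gives the correct label $l_{x_0}\in[m]$ to a sample $x_0\in[0,1]^n$, i.e. $\widehat{\mathcal F}_\Theta(x_0)=l_{x_0}$. Let $a,A,b,c$ be positive reals and $\eta\in(0,1)$ such that: ($C_1$) $|\mathcal F_i(x)-\mathcal F_j(x)|<A$ for all $i,j\in[m]$ and all $x\in S_\infty(x_0,a)$; ($C_2$) $\|W_2^{(i)}-W_2^{(j)}\|_{-\infty}>c$ for all $i,j\in[m]$ with $i\neq j$; ($C_3$) at least $\eta n_1$ coordinates of $|\mathrm{Relu}(W_1x_0+b_1)|$ are bigger than $b$. Let $\gamma,\epsilon$ be positive reals with $\epsilon<a$. If $$n_1>\frac{2A}{\min\{\epsilon\gamma(n-1),\,b\}\,c\,\eta},$$ then there exists $\mathcal F_{\Theta_a}\in\mathcal H_\gamma(\Theta)$ such that $\widehat{\mathcal F}_{\Theta_a}(x_0)=l_{x_0}$ and $\mathcal F_{\Theta_a}$ has an adversarial sample to $x_0$ in $S_\infty(x_0,\epsilon)$.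
   Context: $[m]=\{1,\dots,m\}$. $\mathrm{Relu}(t)=\max\{t,0\}$ is applied coordinatewise. $\mathcal F_i(x)$ is the $i$-th coordinate of $\mathcal F(x)$; $\widehat{\mathcal F}(x)\in[m]$ is the classification result (label) of $\mathcal F$ at $x$, i.e. the index of the largest coordinate of $\mathcal F(x)$. The formula defining the network is evaluated at any point of $\mathbb R^n$. $W^{(i)}$ denotes the $i$-th row of a matrix $W$. For a vector $x$, $\|x\|_{-\infty}=\min_i|x_i|$. $S_\infty(x_0,\epsilon)=\{x\in\mathbb R^n : \|x-x_0\|_\infty\le\epsilon\}$. For a parameter set $\Theta$ viewed as a vector of all weights and biases, $\mathcal H_\gamma(\Theta)=\{\mathcal F_{\Theta_a} : \|\Theta_a-\Theta\|_\infty<\gamma\}$ is the set of networks of the same architecture whose parameters differ from $\Theta$ entrywise by less than $\gamma$. An adversarial sample to $x_0$ in $S_\infty(x_0,\epsilon)$ for a network $\mathcal G$ is a point $x'\in S_\infty(x_0,\epsilon)$ with $\widehat{\mathcal G}(x')\ne l_{x_0}$. *)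

(* Defs.v *)
From HB Require Import structures.
From mathcomp Require Import all_boot all_order all_algebra.
From mathcomp Require Import all_classical all_reals ereal topology normedtype.
Set Implicit Arguments.
Unset Strict Implicit.
Unset Printing Implicit Defensive.
Import Order.TTheory GRing.Theory Num.Theory.
Import numFieldNormedType.Exports.
Local Open Scope classical_set_scope.
Local Open Scope ring_scope.

Section Networks.
Context {R : realType}.

Definition Relu k (v : 'cV[R]_k) : 'cV[R]_k := map_mx (fun t => Num.max t 0) v.

(* A parameter set (W1, b1, W2, b2).  The library norm on a product is the
   maximum of the norms of the components, and the one on matrices is the
   maximum of the absolute values of the entries, so that `|T| is the sup norm
   of T seen as the vector of all weights and biases. *)
Definition params (n n1 m : nat) : Type :=
  ('M[R]_(n1, n) * 'cV[R]_n1 * 'M[R]_(m, n1) * 'cV[R]_m)%type.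

Definition W1 n n1 m (T : params n n1 m) : 'M[R]_(n1, n) := T.1.1.1.
Definition b1 n n1 m (T : params n n1 m) : 'cV[R]_n1 := T.1.1.2.
Definition W2 n n1 m (T : params n n1 m) : 'M[R]_(m, n1) := T.1.2.
Definition b2 n n1 m (T : params n n1 m) : 'cV[R]_m := T.2.

Definition network n n1 m (T : params n n1 m) (x : 'cV[R]_n) : 'cV[R]_m :=
  W2 T *m Relu (W1 T *m x + b1 T) + b2 T.

Definition param_dist n n1 m (T T' : params n n1 m) : R :=
  `|(T - T' : 'M[R]_(n1, n) * 'cV[R]_n1 * 'M[R]_(m, n1) * 'cV[R]_m)|.

Definition Hyp_nbhd n n1 m (gamma : R) (T : params n n1 m) :
    set ('cV[R]_n -> 'cV[R]_m) :=
  [set network Ta | Ta in [set Ta | param_dist Ta T < gamma]].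

(* In 'cV_n, `|_| is the sup norm. *)
Definition Sinfty n (x0 : 'cV[R]_n) (eps : R) : set 'cV[R]_n :=
  [set x | `|x - x0| <= eps].

(* The minimum over the empty index set is +oo, hence the codomain. *)
Definition neginf_norm k (v : 'rV[R]_k) : \bar R :=
  \big[Order.min/+oo%E]_(i < k) (`|v 0 i|)%:E.

(* "The index of the largest coordinate" leaves the choice open in case of
   ties; an argmax rule is any function that makes such a choice. *)
Definition argmax_rule m (cls : 'cV[R]_m -> 'I_m) : Prop :=
  forall (v : 'cV[R]_m) (i : 'I_m), v i 0 <= v (cls v) 0.

Lemma argmax_rule_exists m : (0 < m)%N -> exists cls, @argmax_rule m cls.
Proof.
move=> m0; exists (fun v => [arg max_(i > Ordinal m0) v i 0]%O) => v i.
by case: arg_maxP => //= j _; apply.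
Qed.

Definition label n m (cls : 'cV[R]_m -> 'I_m) (F : 'cV[R]_n -> 'cV[R]_m)
    (x : 'cV[R]_n) : 'I_m := cls (F x).

Definition adversarial_sample n m (cls : 'cV[R]_m -> 'I_m)
    (G : 'cV[R]_n -> 'cV[R]_m) (x0 : 'cV[R]_n) (l : 'I_m) (eps : R)
    (x' : 'cV[R]_n) : Prop :=
  Sinfty x0 eps x' /\ label cls G x' <> l.

End Networks.

(* Main.v *)
Require Import Defs.
From mathcomp Require Import all_boot all_order all_algebra.
From mathcomp Require Import all_classical all_reals ereal topology normedtype.
From mathcomp Require Import ring lra.
Set Implicit Arguments.
Unset Strict Implicit.
Unset Printing Implicit Defensive.
Import Order.TTheory GRing.Theory Num.Theory.
Import numFieldNormedType.Exports.
Local Open Scope classical_set_scope.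
Local Open Scope ring_scope.

(* A rank-one perturbation W1 + s U of the first layer, compensated in the bias
   by - s U x0, does not change the network at x0.  Take the row U with all
   entries of modulus g = gamma (n - 1) / n; since x0 lies in the unit cube, the
   signs of U can be chosen so that |U x0| <= g, which keeps the bias change
   admissible.  Moving x0 by eps along the signs of U, in either direction t,
   shifts the activation of neuron k by t s_k D with D = eps gamma (n - 1).  The
   activations at the two points x0 +- eps sgn U have mean the activation at x0,
   so for one of them at least half of the neurons of (C3) exceed b.  Choosing
   s_k = +-1 on these neurons in favour of some label i <> l raises F_i - F_l
   by more than c min(D, b) for each, hence by more than A in total, while
   F_i - F_l > - A before the perturbation. *)

(** Greedy choice: each new term in [[0, 1]] gets the sign opposite to that of the running sum,
    which thus stays in [[-1, 1]]. Signs are indexed by [nat] so that the induction can extend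
    them. *)
Lemma balanced_signs (R : realDomainType) (n : nat) (f : 'I_n -> R) :
  (forall i, 0 <= f i <= 1) ->
  exists e : nat -> bool, `|\sum_(i < n) (-1) ^+ e i * f i| <= 1.
Proof.
elim: n f => [|n IHn] f f01; first by exists xpred0; rewrite big_ord0 normr0.
have [e He] := IHn (fun i => f (widen_ord (leqnSn n) i)) (fun i => f01 _).
pose S := \sum_(i < n) (-1) ^+ e i * f (widen_ord (leqnSn n) i).
exists (fun k => if (k < n)%N then e k else 0 <= S).
rewrite big_ord_recr /= ltnn.
rewrite (eq_bigr (fun i : 'I_n => (-1) ^+ e i * f (widen_ord (leqnSn n) i)));
  last by move=> i _; rewrite ltn_ord.
have := f01 ord_max; move: He; rewrite -/S !ler_norml.
by case: (lerP 0 S) => S0 /=; rewrite ?expr0 ?expr1; lra.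
Qed.

Lemma ler_mx_norm (R : realType) (p q : nat) (M : 'M[R]_(p, q)) (e : R) :
  0 <= e -> (forall i j, `|M i j| <= e) -> `|M| <= e.
Proof.
move=> e0 Me; rewrite [`|M|]/Num.norm /= mx_normrE.
by apply/bigmax_leP; split=> // -[i j] _; apply: Me.
Qed.

(** An upward shift passes through Relu in full. A downward one may be clipped at [0], but starting
    above [b] it still loses at least [Num.min D b]. *)
Lemma relu_shift_gain (R : realDomainType) (w z b D : R) :
  0 < b < z -> 0 <= D ->
  `|w| * Num.min D b <=
    w * (Num.max (z + Num.sg w * D) 0 - Num.max z 0).
Proof.
move=> /andP[b0 bz] D0; have z0 := lt_trans b0 bz.
rewrite {1}(max_l (ltW z0)).
have mD : Num.min D b <= D by rewrite ge_min lexx.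
have mb : Num.min D b <= b by rewrite ge_min lexx orbT.
case: (ltrgt0P w) => w0.
- rewrite gtr0_sg // mul1r max_l; last by lra.
  by rewrite ler_pM2l //; lra.
- rewrite ltr0_sg // mulN1r mulNr -mulrN ler_nM2l // lerBlDr ge_max.
  by apply/andP; split; lra.
- by rewrite w0 !mul0r.
Qed.

Section Tilt.
Context {R : realType} {n n1 m : nat}.
Implicit Types (T : @params R n n1 m) (s : 'cV[R]_n1) (U : 'rV[R]_n).

Definition tilt T s U (x0 : 'cV[R]_n) : @params R n n1 m :=
  (W1 T + s *m U, b1 T - s *m (U *m x0), W2 T, b2 T).

Lemma network_tilt T s U x0 x : network (tilt T s U x0) x =
  W2 T *m Relu (W1 T *m x + b1 T + (U *m (x - x0)) 0 0 *: s) + b2 T.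
Proof.
rewrite /network /tilt /W1 /W2 /b1 /b2 /=.
congr (_ *m Relu _ + _); rewrite mulmxDl -mulmxA.
rewrite addrACA -mulmxBr -mulmxBr; congr (_ + _).
by rewrite {1}[U *m (x - x0)]mx11_scalar mul_mx_scalar.
Qed.

Lemma network_tilt_center T s U x0 : network (tilt T s U x0) x0 = network T x0.
Proof. by rewrite network_tilt subrr mulmx0 mxE scale0r addr0. Qed.

Lemma param_dist_tilt_le T s U x0 (e : R) : 0 <= e ->
  (forall k, `|s k 0| <= 1) -> (forall j, `|U 0 j| <= e) ->
  `|(U *m x0) 0 0| <= e -> param_dist (tilt T s U x0) T <= e.
Proof.
move=> e0 s1 Ue bias; case: T => [[[w1 c1] w2] c2].
rewrite /param_dist /tilt /W1 /W2 /b1 /b2 /= !prod_normE /= !ge_max.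
rewrite !subrr !normr0 e0 !andbT addrAC subrr add0r addrAC subrr add0r normrN.
apply/andP; split; apply: ler_mx_norm => // i j;
  rewrite mxE big_ord1 normrM -[e]mul1r ler_pM // !ord1 //.
Qed.

End Tilt.

(** The factor [t] in [s] cancels the one in the displacement, so each neuron of [P] moves by [D] in
    the direction of the sign of its weight difference, or stays put if that is zero. The other
    neurons do not move. *)
Lemma network_tilt_gain (R : realType) (n n1 m : nat) (T : params n n1 m)
  (U : 'rV[R]_n) (x0 x : 'cV[R]_n) (i l : 'I_m) (P : {set 'I_n1})
  (b c t D : R) (s : 'cV[R]_n1) :
  0 < b -> 0 <= c -> 0 <= D -> t * t = 1 -> (U *m (x - x0)) 0 0 = t * D ->
  (forall k, k \in P -> b < (W1 T *m x + b1 T) k 0) ->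
  (forall k, k \in P -> c <= `|W2 T i k - W2 T l k|) ->
  (forall k, s k 0 =
     if k \in P then t * Num.sg (W2 T i k - W2 T l k) else 0) ->
  network T x i 0 - network T x l 0 + #|P|%:R * (c * Num.min D b) <=
  network (tilt T s U x0) x i 0 - network (tilt T s U x0) x l 0.
Proof.
move=> b0 c0 D0 tt UD zP wP sE; rewrite network_tilt UD /network.
set z := W1 T *m x + b1 T; set z' := z + _.
have outE (y : 'cV[R]_n1) : (W2 T *m Relu y + b2 T) i 0 -
    (W2 T *m Relu y + b2 T) l 0 =
    \sum_k (W2 T i k - W2 T l k) * Num.max (y k 0) 0 + (b2 T i 0 - b2 T l 0).
  rewrite !mxE opprD addrACA -sumrB; congr (_ + _).
  by apply: eq_bigr => k _; rewrite !mxE mulrBl.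
rewrite !outE addrAC lerD2r -lerBrDl -sumrB.
under eq_bigr do rewrite -mulrBr.
rewrite -sum1_card natr_sum mulr_suml big_mkcond /=.
apply: ler_sum => k _.
have -> : z' k 0 = z k 0 + t * D * s k 0 by rewrite !mxE.
rewrite sE; case: ifP => kP; last by rewrite mulr0 addr0 subrr mulr0.
have -> : t * D * (t * Num.sg (W2 T i k - W2 T l k)) =
    Num.sg (W2 T i k - W2 T l k) * D by rewrite mulrACA tt mul1r mulrC.
have bz : 0 < b < z k 0 by rewrite b0 zP.
rewrite mul1r; apply: le_trans (relu_shift_gain _ bz D0).
by rewrite ler_wpM2r ?wP // le_min D0 ltW.
Qed.

Lemma lt_neginf_norm (R : realType) (k : nat) (v : 'rV[R]_k) (c : R) (i : 'I_k) :
  (c%:E < neginf_norm v)%E -> c < `|v 0 i|.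
Proof. by move=> /lt_le_trans /(_ (bigmin_le _ i _)); rewrite lte_fin. Qed.

Lemma half_active (R : realType) (n n1 : nat) (M : 'M[R]_(n1, n))
  (v : 'cV[R]_n1) (x0 d : 'cV[R]_n) (b : R) :
  exists2 t : R, t = 1 \/ t = -1 &
    (#|[set k : 'I_n1 | b < (M *m x0 + v) k 0]%R%SET| <=
     2 * #|[set k : 'I_n1 | b < (M *m (x0 + t *: d) + v) k 0]%R%SET|)%N.
Proof.
pose P (t : R) := [set k : 'I_n1 | b < (M *m (x0 + t *: d) + v) k 0]%R%SET.
have cover : [set k : 'I_n1 | b < (M *m x0 + v) k 0]%R%SET \subset P 1 :|: P (-1).
  apply/fintype.subsetP => k; rewrite finset.in_setU !finset.inE.
  rewrite !mulmxDr -!scalemxAr scale1r scaleN1r.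
  move: (M *m x0) (M *m d) => w y; rewrite !mxE => bz.
  by apply/orP; case: (lerP 0 (y k 0)) => yk; [left|right]; lra.
have {cover} := leq_trans (subset_leq_card cover) (leq_card_setU (P 1) (P (-1))).
case: (leqP #|P 1| #|P (-1)|) => [le|/ltnW le] cover.
  by exists (-1); [right|rewrite (leq_trans cover) // mul2n -addnn leq_add2r].
by exists 1; [left|rewrite (leq_trans cover) // mul2n -addnn leq_add2l].
Qed.

Theorem theorem4p1 (R : realType) (n n1 m : nat) (hn : (2 <= n)%N) (hm : (2 <= m)%N)
  (cls : 'cV[R]_m -> 'I_m) (hcls : argmax_rule cls)
  (Theta : params n n1 m) (x0 : 'cV[R]_n) (l : 'I_m)
  (hx0 : forall k : 'I_n, 0 <= x0 k 0 <= 1)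
  (hl : label cls (network Theta) x0 = l)
  (a A b c eta : R) (ha : 0 < a) (hA : 0 < A) (hb : 0 < b) (hc : 0 < c)
  (heta : 0 < eta < 1)
  (C1 : forall (i j : 'I_m) (x : 'cV[R]_n), Sinfty x0 a x ->
     `|network Theta x i 0 - network Theta x j 0| < A)
  (C2 : forall i j : 'I_m, i != j ->
     (c%:E < neginf_norm (row i (W2 Theta) - row j (W2 Theta)))%E)
  (C3 : eta * n1%:R <=
     #|[set k : 'I_n1 | b < `|Relu (W1 Theta *m x0 + b1 Theta) k 0| ]%SET|%:R)
  (gamma eps : R) (hgamma : 0 < gamma) (heps : 0 < eps) (hepsa : eps < a)
  (hn1 : n1%:R > 2 * A / (Num.min (eps * gamma * (n%:R - 1)) b * c * eta)) :
  exists G : 'cV[R]_n -> 'cV[R]_m,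
    [/\ Hyp_nbhd gamma Theta G,
        label cls G x0 = l
      & exists x' : 'cV[R]_n, adversarial_sample cls G x0 l eps x'].
Proof.
have n0 : (0 : R) < n%:R by rewrite ltr0n (leq_trans _ hn).
have n1gt : (1 : R) < n%:R by rewrite ltr1n.
(* The factor [(n - 1) / n] makes [g] strictly smaller than [gamma], while [n] entries of size [g]
   times [eps] still add up to [D]. *)
pose g := gamma * (n%:R - 1) / n%:R; pose D := eps * gamma * (n%:R - 1).
have g0 : 0 < g by rewrite divr_gt0 // mulr_gt0 // subr_gt0.
have gn : g * n%:R = gamma * (n%:R - 1) by rewrite divfK ?gt_eqF.
have ggamma : g < gamma.
  by rewrite ltr_pdivrMr // ltr_pM2l // ltrBlDr ltrDl.
have D0 : 0 < D by rewrite !mulr_gt0 // subr_gt0.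
have [e He] := balanced_signs (f := fun j => x0 j 0) hx0.
pose u : 'rV[R]_n := \row_j (-1) ^+ e j.
have u1 j : `|u 0 j| = 1 by rewrite mxE normrX normrN1 expr1n.
pose U := g *: u.
have [t t1 half] := half_active (W1 Theta) (b1 Theta) x0 (eps *: u^T) b.
have tt : t * t = 1 by case: t1 => ->; rewrite ?mulrNN mulr1.
have tn : `|t| = 1 by case: t1 => ->; rewrite ?normrN1 ?normr1.
move: half; set x' := x0 + _; set P := [set k | b < (_ *m x' + _) k 0]%SET => half.
have dx : `|x' - x0| <= eps.
  rewrite addrAC subrr add0r; apply: ler_mx_norm => [|j k]; first exact: ltW.
  by rewrite (ord1 k) 3!mxE !normrM tn mul1r u1 mulr1 gtr0_norm.
(* The displacement follows the signs of [U], so all [n] products equal [t * eps * g] and nothing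
   cancels. *)
have UD : (U *m (x' - x0)) 0 0 = t * D.
  rewrite addrAC subrr add0r /U -scalemxAl -!scalemxAr !mxE.
  under eq_bigr do rewrite !mxE -expr2 sqrr_sign.
  rewrite sumr_const card_ord; transitivity (t * (eps * (g * n%:R))).
    by rewrite -mulr_natr; ring.
  by rewrite gn /D; ring.
have [i il] : exists i : 'I_m, i != l.
  have [l0|l0] := eqVneq l (Ordinal (leq_trans (isT : (0 < 2)%N) hm)).
    by exists (Ordinal hm); rewrite l0.
  by exists (Ordinal (leq_trans (isT : (0 < 2)%N) hm)); rewrite eq_sym.
have wc k : c < `|W2 Theta i k - W2 Theta l k|.
  by have := lt_neginf_norm k (C2 i l il); rewrite !mxE.
pose s : 'cV[R]_n1 := \col_k
  if k \in P then t * Num.sg (W2 Theta i k - W2 Theta l k) else 0.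
exists (network (tilt Theta s U x0)); split.
- exists (tilt Theta s U x0) => //=; apply: le_lt_trans ggamma.
  apply: param_dist_tilt_le; first exact: ltW.
  + move=> k; rewrite mxE; case: ifP; rewrite ?normr0 // => _.
    by rewrite normrM tn mul1r normr_sg; case: (_ != _).
  + by move=> j; rewrite mxE normrM u1 mulr1 gtr0_norm.
  + rewrite /U -scalemxAl !mxE normrM (gtr0_norm g0) -[leRHS]mulr1 ler_pM2l //.
    by under eq_bigr do rewrite mxE.
- by rewrite /label network_tilt_center.
exists x'; split=> // ll.
(* A strict inequality between coordinates [i] and [l] rules out the label [l] under any
   tie-breaking. *)
have top := hcls (network (tilt Theta s U x0) x') i.
move: top; rewrite -/(label cls (network (tilt Theta s U x0)) x') ll.
apply/negP; rewrite -ltNge -subr_gt0.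
have gain : _ <= _ := network_tilt_gain (i := i) (l := l) (P := P) (b := b)
  hb (ltW hc) (ltW D0) tt UD (s := s) _ (fun k _ => ltW (wc k)) _.
apply: lt_le_trans (gain _ _); last 2 first.
- by move=> k; rewrite inE.
- by move=> k; rewrite mxE.
have := C1 i l x' (le_trans dx (ltW hepsa)); rewrite ltr_norml => /andP[lowA _].
suff : A < #|P|%:R * (c * Num.min D b) by lra.
have M0 : 0 < Num.min D b by rewrite lt_min D0.
have [eta0 _] := andP heta.
have cardP : eta * n1%:R <= 2 * #|P|%:R.
  apply: le_trans C3 _; rewrite -natrM ler_nat; apply: leq_trans half.
  apply: subset_leq_card; apply/fintype.subsetP => k; rewrite !inE mxE.
  (* As [b] is positive, a Relu output above [b] forces the activation itself above [b]. *)
  set z := (W1 Theta *m x0 + b1 Theta) k 0.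
  by case: (leP z 0) => z0; rewrite ?normr0 ?(ltNge b) ?(ltW hb) // gtr0_norm.
(* The [2] in the bound on [n1] pays for keeping only half of the active neurons. *)
move: hn1; rewrite -/D ltr_pdivrMr ?mulr_gt0 // => hn1'.
have : eta * n1%:R * (c * Num.min D b) <= 2 * #|P|%:R * (c * Num.min D b).
  by rewrite ler_wpM2r // mulr_ge0 // ltW.
lra.
Qed.
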